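(* Let $M$ be a Hausdorff space and $\mathcal S\to M$ a topologized sheaf of Abelian groups. Let $\mathfrak U=\{U_i\}_{i\in I}$ and $\mathfrak V=\{V_j\}_{j\in J}$ be open covers of $M$ with $\mathfrak V$ finer than $\mathfrak U$, and suppose that for each $p,q\ge0$ the map $$\delta^{q-1}:C^{q-1}(\mathfrak V|\mathfrak U_p,\pi_p^{-1}\mathcal S)\to Z^q(\mathfrak V|\mathfrak U_p,\pi_p^{-1}\mathcal S)$$ is open. Then for $n\ge0$ the refinement homomorphisms $H^n(\mathfrak U,\mathcal S)\to H^n(\mathfrak V,\mathcal S)$ are open. More precisely, for any refinement map $\tau:J\to I$, the homomorphisms $$Z^n(\mathfrak U,\mathcal S)\oplus C^{n-1}(\mathfrak V,\mathcal S)\ni(f,g)\mapsto f|\mathfrak V+\delta_{\mathfrak V}g\in Z^n(\mathfrak V,\mathcal S)$$ are open for $n\ge0$.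
   Context: A sheaf $\mathcal S$ of Abelian groups over a Hausdorff space $M$ is topologized if for every Hausdorff space $U$ and local homeomorphism $\pi:U\to M$ the group $\Gamma(U,\pi^{-1}\mathcal S)$ carries a topology compatible with its group structure, such that for every further local homeomorphism $\rho:V\to U$ the pullback $\rho^*:\Gamma(U,\pi^{-1}\mathcal S)\to\Gamma(V,(\pi\rho)^{-1}\mathcal S)$ is continuous. Then for a local homeomorphism $\pi:U\to M$, the sheaf $\pi^{-1}\mathcal S$ over $U$ is again topologized in the evident way. For an open cover $\mathfrak U=\{U_i\}_{i\in I}$ and $q\ge-1$: for $s=(i_0,\dots,i_q)\in I^{q+1}$, $U_s=U_{i_0}\cap\dots\cap U_{i_q}$ ($I^0=\{\emptyset\}$, $U_\emptyset=M$); $\mathfrak U_q=\coprod_{s\in I^{q+1}}U_s$ with the local homeomorphism $\pi_q:\mathfrak U_q\to M$ restricting to the inclusion on each $U_s$. $C^q(\mathfrak U,\mathcal S)=\prod_{s\in I^{q+1}}\Gamma(U_s,\mathcal S)$ (not necessarily alternating cochains) carries the topology transported from $\Gamma(\mathfrak U_q,\pi_q^{-1}\mathcal S)$ via $f\mapsto(f|U_s)_s$. The Čech differential is $(\delta f)_{i_0\dots i_{q+1}}=\sum_{k=0}^{q+1}(-1)^kf_{i_0\dots\hat i_k\dots i_{q+1}}|U_{i_0\dots i_{q+1}}$ for $q\ge0$, and $\delta^{-1}:\Gamma(M,\mathcal S)\to C^0$ is $f\mapsto(f|U_i)_i$. $Z^q=\ker\delta^q$ with subspace topology; $H^0=Z^0$,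 $H^q=Z^q/\mathrm{Im}\,\delta^{q-1}$ with quotient topology. $\mathfrak V|\mathfrak U_p$ denotes the open cover $\{\pi_p^{-1}V_j\}_{j\in J}$ of $\mathfrak U_p$. A refinement map $\tau:J\to I$ satisfies $V_j\subset U_{\tau(j)}$ and induces $(f|\mathfrak V)_{j_0\dots j_n}=f_{\tau(j_0)\dots\tau(j_n)}|V_{j_0\dots j_n}$. *)

(* Defs.v *)
From HB Require Import structures.
From mathcomp Require Import all_boot all_algebra.
From mathcomp Require Import all_classical topology.
Set Implicit Arguments.
Unset Strict Implicit.
Unset Printing Implicit Defensive.
Local Open Scope classical_set_scope.

Section Defs.
Variable M : topologicalType.

Definition local_homeo {X Y : topologicalType} (f : X -> Y) : Prop :=
  continuous f /\
  forall x, exists W : set X,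
    [/\ open W, W x, open (f @` W),
        (forall a b, W a -> W b -> f a = f b -> a = b) &
        (forall A, open A -> A `<=` W -> open (f @` A))].

(* A sheaf of Abelian groups S -> M, given as its etale space E with the
   projection p, fibrewise group operations that are continuous
   (zero section, negation, addition on the fibre product E x_M E). *)
Record sheafAb := SheafAb {
  sh_E : topologicalType;
  sh_p : sh_E -> M;
  sh_zero : M -> sh_E;
  sh_add : sh_E -> sh_E -> sh_E;
  sh_opp : sh_E -> sh_E;
  sh_p_lh : local_homeo sh_p;
  sh_zeroP : forall x, sh_p (sh_zero x) = x;
  sh_addP : forall a b, sh_p a = sh_p b -> sh_p (sh_add a b) = sh_p a;
  sh_oppP : forall a, sh_p (sh_opp a) = sh_p a;
  sh_addA : forall a b c, sh_p a = sh_p b -> sh_p b = sh_p c ->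
     sh_add a (sh_add b c) = sh_add (sh_add a b) c;
  sh_addC : forall a b, sh_p a = sh_p b -> sh_add a b = sh_add b a;
  sh_add0 : forall a, sh_add (sh_zero (sh_p a)) a = a;
  sh_addN : forall a, sh_add (sh_opp a) a = sh_zero (sh_p a);
  sh_zero_cont : continuous sh_zero;
  sh_opp_cont : continuous sh_opp;
  sh_add_cont : forall a b, sh_p a = sh_p b -> forall W, nbhs (sh_add a b) W ->
     exists A B, [/\ nbhs a A, nbhs b B &
       forall a' b', A a' -> B b' -> sh_p a' = sh_p b' -> W (sh_add a' b')]
}.

Arguments sh_p : clear implicits.
Arguments sh_zero : clear implicits.
Arguments sh_add : clear implicits.
Arguments sh_opp : clear implicits.

Variable S : sheafAb.
Local Notation E := (sh_E S).

(* Gamma(U, pi^{-1} S): continuous lifts of pi : U -> M to the etale space. *)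
Definition sections {U : topologicalType} (pi : U -> M) : set (U -> E) :=
  [set s | continuous s /\ forall u, sh_p S (s u) = pi u].

Definition sec_zero {U : Type} (pi : U -> M) : U -> E := fun u => sh_zero S (pi u).
Definition sec_add {U : Type} (s t : U -> E) : U -> E := fun u => sh_add S (s u) (t u).
Definition sec_opp {U : Type} (s : U -> E) : U -> E := fun u => sh_opp S (s u).

Definition is_topology_on {T} (X : set T) (O : set (set T)) : Prop :=
  [/\ (forall A, O A -> A `<=` X), O X,
      (forall A B, O A -> O B -> O (A `&` B)) &
      (forall F : set (set T), F `<=` O -> O (\bigcup_(A in F) A))].

Definition subspace_opens {T} (O : set (set T)) (Z : set T) : set (set T) :=
  [set A | exists B, O B /\ A = Z `&` B].

Definition prod_opens {T1 T2} (O1 : set (set T1)) (O2 : set (set T2))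
  : set (set (T1 * T2)) :=
  [set A | forall z, A z -> exists B1 B2,
     [/\ O1 B1, O2 B2, B1 z.1, B2 z.2 & B1 `*` B2 `<=` A]].

Definition open_map_on {T1 T2} (O1 : set (set T1)) (O2 : set (set T2))
  (f : T1 -> T2) : Prop := forall A, O1 A -> O2 (f @` A).

(* A topologization: for every space U and map pi : U -> M a collection of
   "open" sets of sections; the requirements below are imposed for every
   Hausdorff U and local homeomorphism pi, as in the paper. *)
Definition topologization :=
  forall U : topologicalType, (U -> M) -> set (set (U -> E)).

Definition is_topologization (top : topologization) : Prop :=
  (forall (U : topologicalType) (pi : U -> M),
     hausdorff_space U -> local_homeo pi ->
     [/\ is_topology_on (sections pi) (top U pi),
         (forall s t, sections pi s -> sections pi t ->
            forall W, top U pi W -> W (sec_add s t) ->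
            exists A B, [/\ top U pi A, top U pi B, A s, B t &
              forall s' t', A s' -> B t' -> W (sec_add s' t')]) &
         (forall W, top U pi W ->
            top U pi [set s | sections pi s /\ W (sec_opp s)])]) /\
  (forall (U V : topologicalType) (pi : U -> M) (rho : V -> U),
     hausdorff_space U -> hausdorff_space V ->
     local_homeo pi -> local_homeo rho ->
     forall W, top V (pi \o rho) W ->
       top U pi [set s | sections pi s /\ W (s \o rho)]).

(* Cech cochains of an open cover W : K -> set X of a space X equipped with
   a map piX : X -> M, with values in piX^{-1} S.  Cochains with m indices
   (i.e. of degree m - 1) are sections over the disjoint union
   X_(m-1) = coprod_{s in K^m} W_s. *)
Section Cech.
Variables (X : topologicalType) (piX : X -> M) (K : choiceType) (W : K -> set X).

Definition inter (m : nat) (s : {ffun 'I_m -> K}) : set X :=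
  [set x | forall k : 'I_m, W (s k) x].

Definition nerve_fam (m : nat) (s : {ffun 'I_m -> K}) : topologicalType :=
  set_type (inter s).

Definition nerve (m : nat) : topologicalType := {s : {ffun 'I_m -> K} & nerve_fam s}.

Definition nproj (m : nat) (z : nerve m) : X := set_val (projT2 z).

Definition nidx (m : nat) (z : nerve m) : {ffun 'I_m -> K} := projT1 z.

Definition cochains (m : nat) : set (nerve m -> E) := sections (piX \o @nproj m).

Definition cochain_opens (top : topologization) (m : nat) :=
  top (nerve m) (piX \o @nproj m).

Definition ceval (m : nat) (f : nerve m -> E) (s : {ffun 'I_m -> K}) (x : X) : E :=
  match pselect (inter s x) with
  | left h => f (existT _ s (exist _ x (mem_set h)))
  | right _ => sh_zero S (piX x)
  end.

Definition sh_sum (x : M) (l : seq E) : E := foldr (sh_add S) (sh_zero S x) l.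

Definition sign_E (k : nat) (a : E) : E := if odd k then sh_opp S a else a.

Definition cech_delta (m : nat) (f : nerve m -> E) : nerve m.+1 -> E :=
  fun z => sh_sum (piX (nproj z))
    [seq sign_E k (ceval f [ffun i : 'I_m => nidx z (lift k i)] (nproj z))
    | k : 'I_m.+1].

Definition cocycles (m : nat) : set (nerve m -> E) :=
  [set f | cochains f /\ cech_delta f = sec_zero (piX \o @nproj m.+1)].

End Cech.

Definition open_cover {X : topologicalType} {K : Type} (W : K -> set X) : Prop :=
  (forall k, open (W k)) /\ \bigcup_k W k = setT.

Definition cech_refine {X : topologicalType} (piX : X -> M)
  {I J : choiceType} (U : I -> set X) (V : J -> set X) (tau : J -> I)
  (m : nat) (f : nerve U m -> E) : nerve V m -> E :=
  fun z => ceval piX f [ffun i => tau (nidx z i)] (nproj z).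

End Defs.

(* Main.v *)
(* A cocycle [c] of [V] over [M] is chased through the double complex
   [C^{p,q}] of sections over the intersections [U_s /\ V_t], with differentials
   [D'] and [D''].  Openness of [D''] makes every lift small: [D' c = D'' b_0],
   [D' b_0 = D'' b_1], ..., until [b_n] comes from a small cocycle [f] of [U].
   The Alexander-Whitney map
     [(Psi b)_{j_0..j_{p+q}} = b_{tau j_0..tau j_p; j_p..j_{p+q}}]
   satisfies [delta Psi = Psi D' + (-1)^p Psi D''], sends [D' c] back to [c] and
   [D'' f] to [f|V], so that [c = +/- f|V + delta g] with
   [g = sum_k +/- Psi b_k] small as well. *)

(* Additivity reduces openness to neighbourhoods of zero, and there openness of [D''] says that the
   image of a neighbourhood of zero contains every cocycle close enough to zero. Sizes therefore
   have to be fixed backwards: the neighbourhoods prescribed for [f] and [g] come first, and each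
   passage from [b_k] to [b_(k-1)] determines how small the earlier cochain must be, while the
   cochains themselves are found in the opposite order. This is why the induction produces a
   neighbourhood before any cocycle is given. Only [D''] is ever inverted. Every other map in the
   chase, [Psi] and [D'] included, is composed of fibrewise sums, signs and pullbacks along
   continuous maps over [M], so the axioms of a topologized sheaf make it continuous at zero. *)
From HB Require Import structures.
Require Import Defs.
From mathcomp Require Import all_boot all_algebra zify.
From mathcomp Require Import all_classical topology.
Set Implicit Arguments.
Unset Strict Implicit.
Unset Printing Implicit Defensive.
Import GRing.Theory.
Local Open Scope classical_set_scope.

(** * Alternating sums in the fibres *)

Section AlternatingSums.
Local Open Scope ring_scope.
Variable G : zmodType.
Local Notation sg k := ((-1) ^+ k : int).

Lemma mulrz_signS (a : G) k : a *~ sg k.+1 = - (a *~ sg k).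
Proof. by rewrite exprS mulN1r mulrNz. Qed.

Lemma mulrz_signK (a : G) k : a *~ sg k *~ sg k = a.
Proof. by rewrite -mulrzA -exprMn mulrNN mulr1 expr1n mulr1z. Qed.

(** By induction on [n]: the array gains a last row and a last column, which cancel entry by entry.
    With [H i j] the value at the [j]-th face of the [i]-th face this gives [delta delta = 0]. *)
Lemma alternating_sum_sq0 (H : nat -> nat -> G) n :
  (forall i j, (i <= j)%N -> H j.+1 i = H i j) ->
  \sum_(0 <= i < n.+1) (\sum_(0 <= j < n) H i j *~ sg j) *~ sg i = 0.
Proof.
move=> HH; elim: n => [|n IH]; first by rewrite big_nat1 big_geq.
rewrite big_nat_recr //=.
under eq_bigr => i _ do rewrite big_nat_recr //= mulrzDl.
rewrite big_split /= IH add0r.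
rewrite (_ : _ *~ sg n.+1 = - \sum_(0 <= i < n.+1) H i n *~ sg n *~ sg i) ?subrr //.
rewrite mulrz_signS; congr (- _).
rewrite mulrz_suml.
by apply: eq_big_nat => i /andP[_ lin]; rewrite HH // mulrzAC.
Qed.

(** The common value [A p.+1 = B 0] ends the first sum with sign [(-1)^(p+1)] and starts the second
    with sign [(-1)^p], so it cancels; the remaining terms are those on the left. *)
Lemma alternating_sum_split (A B : nat -> G) p q : A p.+1 = B 0%N ->
  \sum_(0 <= k < (p + q).+2) (if (k <= p)%N then A k else B (k - p)%N) *~ sg k =
  \sum_(0 <= k < p.+2) A k *~ sg k
    + (\sum_(0 <= l < q.+2) B l *~ sg l) *~ sg p.
Proof.
move=> AB; rewrite (@big_cat_nat _ _ _ p.+1) //=; last by lia.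
rewrite [X in _ = X + _]big_nat_recr //= -addrA; congr (_ + _).
  by apply: eq_big_nat => i /andP[_ ip]; rewrite -ltnS ip.
rewrite [\sum_(0 <= l < q.+2) _]big_nat_recl //= mulrzDl addrA AB mulr1z mulrz_signS.
rewrite addNr add0r -{1}[p.+1]add0n big_addn.
rewrite (_ : ((p + q).+2 - p.+1 = q.+1)%N); last by lia.
rewrite mulrz_suml.
apply: eq_big_nat => i _; rewrite ifF; last by lia.
by rewrite -mulrzA -exprD addnS addSn (_ : (i + p).+1 - p = i.+1)%N //; lia.
Qed.

End AlternatingSums.

(** * Stalks as abelian groups *)

Section Fibre.
Variables (M : topologicalType) (S : sheafAb M).

(** Addition on [sh_E S] is a group law only within one fibre. Packing a fibre as a [zmodType] makes
    big sums available; identities of sections are then proved point by point through [germ_inj]. *)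
Record fib (x : M) := Fib { fib_val : sh_E S; _ : sh_p fib_val == x }.

HB.instance Definition _ x := [isSub for @fib_val x].
HB.instance Definition _ x := [Choice of fib x by <:].

Lemma fibP x (a : fib x) : sh_p (val a) = x.
Proof. exact/eqP/(valP a). Qed.

Definition fib_zero x : fib x := Fib (introT eqP (sh_zeroP S x)).

Lemma fib_add_subproof x (a b : fib x) : sh_p (sh_add (val a) (val b)) == x.
Proof. by rewrite sh_addP !fibP. Qed.
Definition fib_add x (a b : fib x) := Fib (fib_add_subproof a b).

Lemma fib_opp_subproof x (a : fib x) : sh_p (sh_opp (val a)) == x.
Proof. by rewrite sh_oppP fibP. Qed.
Definition fib_opp x (a : fib x) := Fib (fib_opp_subproof a).

Lemma fib_addA x : associative (@fib_add x).
Proof. by move=> a b c; apply: val_inj; rewrite /= sh_addA ?fibP. Qed.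

Lemma fib_addC x : commutative (@fib_add x).
Proof. by move=> a b; apply: val_inj; rewrite /= sh_addC ?fibP. Qed.

Lemma fib_add0 x : left_id (fib_zero x) (@fib_add x).
Proof.
by move=> a; apply: val_inj; rewrite /= -[in sh_zero S x](fibP a) sh_add0.
Qed.

Lemma fib_addN x : left_inverse (fib_zero x) (@fib_opp x) (@fib_add x).
Proof. by move=> a; apply: val_inj; rewrite /= sh_addN fibP. Qed.

HB.instance Definition _ x := GRing.isZmodule.Build (fib x)
  (@fib_addA x) (@fib_addC x) (@fib_add0 x) (@fib_addN x).

Local Open Scope ring_scope.

(* Off the fibre over [x] the value of [germ x] is the junk value [0]. *)
Definition germ x (e : sh_E S) : fib x := insubd (0 : fib x) e.

Lemma germK x e : sh_p e = x -> val (germ x e) = e.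
Proof. by move=> /eqP ex; rewrite /germ insubdK. Qed.

Lemma germ_inj x a b : sh_p a = x -> sh_p b = x -> germ x a = germ x b -> a = b.
Proof. by move=> ax bx /(congr1 val); rewrite !germK. Qed.

Lemma germ0 x : germ x (sh_zero S x) = 0.
Proof. by apply: val_inj; rewrite germK ?sh_zeroP. Qed.

Lemma germD x a b : sh_p a = x -> sh_p b = x ->
  germ x (sh_add a b) = germ x a + germ x b.
Proof. by move=> ax bx; apply: val_inj; rewrite /= !germK ?sh_addP ?ax ?bx. Qed.

Lemma germN x a : sh_p a = x -> germ x (sh_opp a) = - germ x a.
Proof. by move=> ax; apply: val_inj; rewrite /= !germK ?sh_oppP ?ax. Qed.

Lemma sign_EP k (a : sh_E S) : sh_p (sign_E k a) = sh_p a.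
Proof. by rewrite /sign_E; case: ifP => // _; rewrite sh_oppP. Qed.

Lemma germ_sign x k a : sh_p a = x ->
  germ x (sign_E k a) = germ x a *~ ((-1) ^+ k).
Proof.
move=> ax; rewrite -signr_odd /sign_E; case: ifP => _; last by rewrite expr0 mulr1z.
by rewrite expr1 mulrNz mulr1z germN.
Qed.

Lemma germ_sum x (T : Type) (l : seq T) (g : T -> sh_E S) :
  (forall t, sh_p (g t) = x) ->
  sh_p (sh_sum x (map g l)) = x /\
  germ x (sh_sum x (map g l)) = \sum_(t <- l) germ x (g t).
Proof.
move=> gx; elim: l => [|t l [IH1 IH2]] /=; first by rewrite big_nil sh_zeroP germ0.
by rewrite big_cons sh_addP ?gx ?IH1 // germD // IH2.
Qed.

End Fibre.

Section AltSum.
Variables (M : topologicalType) (S : sheafAb M).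
Local Notation E := (sh_E S).

(** Common form of both differentials of the double complex. Indexing the maps [phi] by [nat]
    instead of ordinals keeps face identities free of casts. *)
Definition altsum (Y Y' : Type) (pi' : Y' -> M) (n : nat) (phi : nat -> Y' -> Y)
    (f : Y -> E) : Y' -> E :=
  fun z => sh_sum (pi' z) [seq sign_E k (f (phi k z)) | k <- index_iota 0 n].

Variables (Y Y' : Type) (pi : Y -> M) (pi' : Y' -> M) (phi : nat -> Y' -> Y).
Variable f : Y -> E.
Hypotheses (fP : forall y, sh_p (f y) = pi y).
Hypotheses (phiP : forall k z, pi (phi k z) = pi' z).

Lemma altsumP n z : sh_p (altsum pi' n phi f z) = pi' z.
Proof.
by case: (germ_sum (x := pi' z) (index_iota 0 n) (g := fun k => sign_E k (f (phi k z))))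
  => // t; rewrite sign_EP fP.
Qed.

Lemma germ_altsum n z x : pi' z = x ->
  germ x (altsum pi' n phi f z) =
  (\sum_(0 <= k < n) germ x (f (phi k z)) *~ ((-1) ^+ k))%R.
Proof.
move=> <-; rewrite /altsum.
case: (germ_sum (x := pi' z) (index_iota 0 n) (g := fun k => sign_E k (f (phi k z)))).
  by move=> t; rewrite sign_EP fP.
by move=> _ ->; apply: eq_bigr => k _; rewrite germ_sign // fP.
Qed.

End AltSum.

(** * Topology of the nerve *)

Section LocalHomeo.
Variables (X Y Z : topologicalType).

Lemma local_homeo_comp (f : X -> Y) (g : Y -> Z) :
  local_homeo f -> local_homeo g -> local_homeo (g \o f).
Proof.
move=> [cf lf] [cg lg]; split=> [x|x]; first by
  apply: continuous_comp; [exact: cf | exact: cg].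
have [W [oW Wx _ injf opf]] := lf x; have [W' [oW' Wx' _ injg opg]] := lg (f x).
have oI : open (W `&` f @^-1` W').
  by apply: openI => //; move/continuousP: cf; apply.
have op A : open A -> A `<=` W `&` f @^-1` W' -> open ((g \o f) @` A).
  move=> oA AW; rewrite -image_comp; apply: opg.
    by apply: opf => // a /AW [].
  by move=> _ [a /AW [_ ?] <-].
exists (W `&` f @^-1` W'); split=> //; first exact: op.
by move=> a b [Wa W'a] [Wb W'b] /injg/injf; apply.
Qed.

Lemma local_homeo_over (f : X -> Y) (g : Y -> Z) :
  continuous f -> local_homeo g -> local_homeo (g \o f) -> local_homeo f.
Proof.
move=> cf [cg lg] [_ lgf]; split=> // x.
have [W [oW Wx _ injf opf]] := lgf x; have [W' [oW' Wx' _ injg opg]] := lg (f x).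
have oI : open (W `&` f @^-1` W').
  by apply: openI => //; move/continuousP: cf; apply.
have op A : open A -> A `<=` W `&` f @^-1` W' -> open (f @` A).
  move=> oA AW.
  rewrite (_ : f @` A = W' `&` g @^-1` ((g \o f) @` A)).
    apply: openI => //; move/continuousP: cg; apply; apply: opf => //.
    by move=> a /AW [].
  apply/seteqP; split=> [_ [a Aa <-]|y [W'y [a Aa /= e]]].
    by split; [case: (AW a Aa) | exists a].
  by exists a => //; apply: injg => //; case: (AW a Aa).
exists (W `&` f @^-1` W'); split=> //; first exact: op.
by move=> a b [Wa _] [Wb _] e; apply: injf => //=; rewrite e.
Qed.

End LocalHomeo.

Section Nerve.
Variables (X : topologicalType) (K : choiceType) (W : K -> set X) (m : nat).

Lemma nerveP (z : nerve W m) : inter W (nidx z) (nproj z).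
Proof. by case: z => s [x hx]; exact: set_mem hx. Qed.

(** Maps into a nerve are built this way so that continuity splits into a locally constant index and
    a continuous point of [X]. *)
Definition nerve_lift (Y : Type) (T : Y -> {ffun 'I_m -> K}) (Q : Y -> X)
    (h : forall y, inter W (T y) (Q y)) : Y -> nerve W m :=
  fun y => existT (nerve_fam W (m:=m)) (T y) (exist _ (Q y) (mem_set (h y))).

Lemma nerve_eq (z z' : nerve W m) :
  nidx z = nidx z' -> nproj z = nproj z' -> z = z'.
Proof.
case: z z' => [s [x hx]] [s' [x' hx']]; rewrite /nidx /nproj /= => e.
case: s' / e hx' => hx'; rewrite /set_val /= => e.
by case: x' / e hx' => hx'; congr existT; congr exist; exact: bool_irrelevance.
Qed.

Lemma nerve_nbhsP (z : nerve W m) (A : set (nerve W m)) :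
  nbhs z A <-> exists2 O, nbhs (nproj z) O &
    forall z', nidx z' = nidx z -> O (nproj z') -> A z'.
Proof.
(* In a disjoint union the neighbourhoods of a point are, by definition, those whose preimage in its
   own summand is a neighbourhood. *)
case: z => s x; change (nbhs x (existT (nerve_fam W (m:=m)) s @^-1` A) <->
  exists2 O, nbhs (set_val x) O & forall z', nidx z' = s -> O (nproj z') -> A z').
split.
  case=> B; case=> [[O oO <-] /= Ox sub] {B}; exists O; first exact: open_nbhs_nbhs.
  case=> s' x'; rewrite /nidx /nproj /= => e; case: s / e x Ox sub => x Ox sub Ox'.
  exact: sub.
case=> O; rewrite nbhsE => -[O' [oO' O'x] sub] H.
exists (set_val @^-1` O'); split; [by exists O' | exact: O'x |].
by move=> x' /sub Ox'; apply: H.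
Qed.

Lemma nproj_continuous : continuous (@nproj X K W m).
Proof. by move=> z A nA; apply/nerve_nbhsP; exists A. Qed.

Lemma nidx_near (z : nerve W m) : nbhs z [set z' | nidx z' = nidx z].
Proof. by apply/nerve_nbhsP; exists setT => //; exact: filterT. Qed.

Lemma nerve_lift_continuous (Y : topologicalType) (T : Y -> {ffun 'I_m -> K})
    (Q : Y -> X) (h : forall y, inter W (T y) (Q y)) :
  (forall y, nbhs y [set y' | T y' = T y]) -> continuous Q ->
  continuous (nerve_lift h).
Proof.
move=> cT cQ y A /nerve_nbhsP [O nO sub].
rewrite nbhs_simpl; apply: (filterS2 _ _ (cT y) (cQ y _ nO)) => y' /= Ty' Oy'.
exact: sub.
Qed.

Hypothesis Wo : forall k, open (W k).

Lemma inter_open (s : {ffun 'I_m -> K}) : open (inter W s).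
Proof.
rewrite openE => x hx; rewrite /interior.
apply: (@filter_forall _ 'I_m (fun k => W (s k))) => k.
by apply: open_nbhs_nbhs; split => //; exact: hx.
Qed.

Lemma nproj_local_homeo : local_homeo (@nproj X K W m).
Proof.
split; first exact: nproj_continuous.
move=> z; set N := [set z' : nerve W m | nidx z' = nidx z].
have oN : open N by rewrite openE => z' /= e; have := nidx_near z'; rewrite e.
have op (A : set (nerve W m)) : open A -> A `<=` N -> open (@nproj X K W m @` A).
  move=> oA AN; rewrite openE => _ [y Ay <-]; rewrite /interior.
  have /nerve_nbhsP [O nO sub] : nbhs y A by apply: open_nbhs_nbhs.
  have := open_nbhs_nbhs (conj (inter_open (nidx y)) (nerveP y)).
  apply: filterS2 nO => x Ox hx.
  (* The point over [x] with the indices of [y]; the domain [unit] makes [nerve_lift] yield a single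
     point. *)
  exists (@nerve_lift unit (fun=> nidx y) (fun=> x) (fun=> hx) tt) => //.
  exact: sub.
exists N; split=> //; first exact: op.
by move=> a b Na Nb; apply: nerve_eq; rewrite Na Nb.
Qed.

Lemma nerve_hausdorff : hausdorff_space X -> hausdorff_space (nerve W m).
Proof.
move=> hX p q pq; apply: nerve_eq.
  by have [z [/= -> ->]] := pq _ _ (nidx_near p) (nidx_near q).
apply: hX => A B nA nB.
have [z [/= Az Bz]] := pq _ _ (@nproj_continuous p A nA) (@nproj_continuous q B nB).
by exists (nproj z).
Qed.

End Nerve.

(** * Continuity at the zero section *)

Section Sections.
Variables (M : topologicalType) (S : sheafAb M).
Local Notation E := (sh_E S).

Definition sec_sign (Y : Type) (k : nat) (s : Y -> E) : Y -> E :=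
  fun y => sign_E k (s y).

Variables (Y : topologicalType) (pi : Y -> M).

Lemma sections_zero : continuous pi -> sections pi (sec_zero S pi).
Proof.
move=> cpi; split=> [y|y]; last exact: sh_zeroP.
by apply: continuous_comp; [exact: cpi | exact: sh_zero_cont].
Qed.

Lemma sections_add (s t : Y -> E) :
  sections pi s -> sections pi t -> sections pi (sec_add s t).
Proof.
move=> [cs ps] [ct pt]; have pst y : sh_p (s y) = sh_p (t y) by rewrite ps pt.
split=> [y W|y]; last by rewrite sh_addP.
move=> /(sh_add_cont (pst y)) [A [B [nA nB AB]]].
have {}nA : nbhs y (s @^-1` A) := cs y _ nA; have {}nB := ct y _ nB.
by apply: filterS2 nA nB => y' As Bt; apply: AB.
Qed.

Lemma sections_opp (s : Y -> E) : sections pi s -> sections pi (sec_opp s).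
Proof.
move=> [cs ps]; split=> [y|y]; last by rewrite sh_oppP.
by apply: continuous_comp; [exact: cs | exact: sh_opp_cont].
Qed.

Lemma sections_sign k (s : Y -> E) : sections pi s -> sections pi (sec_sign k s).
Proof. by rewrite /sec_sign /sign_E; case: (odd k) => //; exact: sections_opp. Qed.

Lemma sections_pull (Y' : topologicalType) (pi' : Y' -> M) (phi : Y' -> Y) (s : Y -> E) :
  continuous phi -> pi \o phi =1 pi' -> sections pi s -> sections pi' (s \o phi).
Proof.
move=> cphi e [cs ps]; split=> [y|y]; last by rewrite /= ps -e.
by apply: continuous_comp; [exact: cphi | exact: cs].
Qed.

End Sections.

Lemma sections_altsum (M : topologicalType) (S : sheafAb M)
    (Y Y' : topologicalType) (pi : Y -> M) (pi' : Y' -> M)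
    (phi : nat -> Y' -> Y) (n : nat) (s : Y -> sh_E S) :
  continuous pi' -> (forall k, continuous (phi k)) -> (forall k, pi \o phi k =1 pi') ->
  sections pi s -> sections pi' (altsum pi' n phi s).
Proof.
move=> cpi' cphi e ss; rewrite /altsum; elim: (index_iota 0 n) => [|k l IH] /=.
  exact: sections_zero.
apply: (@sections_add _ _ _ _ (sec_sign k (s \o phi k))) IH.
by apply: sections_sign; apply: sections_pull ss.
Qed.

Section TopologizedSheaf.
Variables (M : topologicalType) (S : sheafAb M) (top : topologization S).
Hypothesis htop : is_topologization top.
Local Notation E := (sh_E S).

Definition etale (Y : topologicalType) (pi : Y -> M) :=
  hausdorff_space Y /\ local_homeo pi.

Definition nbhs0 (Y : topologicalType) (pi : Y -> M) (A : set (Y -> E)) :=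
  top pi A /\ A (sec_zero S pi).

(** Continuity at zero only: the maps it serves are additive, and other base points are reached by
    translation. *)
Definition small_map (Y Y' : topologicalType) (pi : Y -> M) (pi' : Y' -> M)
    (T : (Y -> E) -> (Y' -> E)) :=
  forall W, nbhs0 pi' W -> exists2 A, nbhs0 pi A & forall s, A s -> W (T s).

Section OneSpace.
Variables (Y : topologicalType) (pi : Y -> M).
Hypothesis epi : etale pi.

Let top_spec := htop.1 _ _ epi.1 epi.2.

Lemma top_sections A s : top pi A -> A s -> sections pi s.
Proof. by case: top_spec => -[sub _ _ _] _ _ /sub; apply. Qed.

Lemma nbhs0_sections : nbhs0 pi (sections pi).
Proof.
by case: top_spec => -[_ ? _ _] _ _; split=> //; apply: sections_zero; case: epi => _ [].
Qed.

Lemma nbhs0I A B : nbhs0 pi A -> nbhs0 pi B -> nbhs0 pi (A `&` B).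
Proof. by case: top_spec => -[_ _ topI _] _ _ [? ?] [? ?]; split; [apply: topI|]. Qed.

Lemma sec_addr0 (s : Y -> E) : sections pi s -> sec_add s (sec_zero S pi) = s.
Proof.
move=> [_ ps]; apply: funext => y; rewrite /sec_add /sec_zero -ps.
by rewrite sh_addC ?sh_zeroP // sh_add0.
Qed.

Lemma sec_addrN (s : Y -> E) : sections pi s -> sec_add s (sec_opp s) = sec_zero S pi.
Proof.
move=> [_ ps]; apply: funext => y; rewrite /sec_add /sec_zero -ps.
by rewrite sh_addC ?sh_oppP // sh_addN.
Qed.

Lemma sec_opp0 : sec_opp (sec_zero S pi) = sec_zero S pi.
Proof.
have z0 : sections pi (sec_zero S pi) := top_sections nbhs0_sections.1 nbhs0_sections.2.
rewrite -[RHS](sec_addrN z0); apply: funext => y.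
by have := sh_add0 (sec_opp (sec_zero S pi) y); rewrite sh_oppP sh_zeroP.
Qed.

Lemma nbhs0_add W : nbhs0 pi W -> exists A B, [/\ nbhs0 pi A, nbhs0 pi B &
  forall s t, A s -> B t -> W (sec_add s t)].
Proof.
move=> [tW W0]; case: nbhs0_sections => _ z0; case: top_spec => _ tadd _.
have [|A [B [tA tB A0 B0 AB]]] := tadd _ _ z0 z0 _ tW; first by rewrite sec_addr0.
by exists A, B.
Qed.

Lemma nbhs0_translate W s0 : top pi W -> W s0 ->
  exists2 A, nbhs0 pi A & forall s, A s -> W (sec_add s0 s).
Proof.
move=> tW Ws0; have ss0 := top_sections tW Ws0; case: top_spec => _ tadd _.
have [|A [B [tA tB As Bs AB]]] := tadd s0 _ ss0 nbhs0_sections.2 _ tW.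
  by rewrite sec_addr0.
by exists B => // s; apply: AB.
Qed.

Lemma nbhs0_translateN A s0 : nbhs0 pi A -> sections pi s0 ->
  exists2 B, top pi B /\ B s0 & forall s, B s -> A (sec_add s (sec_opp s0)).
Proof.
move=> [tA A0] ss0; case: top_spec => _ tadd _.
have [|B [C [tB _ Bs Cs BC]]] := tadd s0 _ ss0 (sections_opp ss0) _ tA.
  by rewrite sec_addrN.
by exists B => // s Bs'; apply: BC.
Qed.

End OneSpace.

Section SmallMaps.
Variables (Y Y' : topologicalType) (pi : Y -> M) (pi' : Y' -> M).
Hypotheses (epi : etale pi) (epi' : etale pi').

Lemma small_id : small_map pi pi id.
Proof. by move=> W nW; exists W. Qed.

Lemma small_zero : small_map pi pi' (fun=> sec_zero S pi').
Proof. by move=> W [_ W0]; exists (sections pi); first exact: nbhs0_sections. Qed.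

Lemma small_add T1 T2 : small_map pi pi' T1 -> small_map pi pi' T2 ->
  small_map pi pi' (fun s => sec_add (T1 s) (T2 s)).
Proof.
move=> sT1 sT2 W /(nbhs0_add epi') [A [B [nA nB AB]]].
have [A' nA' A'A] := sT1 A nA; have [B' nB' B'B] := sT2 B nB.
exists (A' `&` B'); first exact: nbhs0I.
by move=> s [/A'A ? /B'B ?]; apply: AB.
Qed.

Lemma small_opp T : small_map pi pi' T -> small_map pi pi' (fun s => sec_opp (T s)).
Proof.
move=> sT W [tW W0]; have z0 := nbhs0_sections epi'.
case: (htop.1 _ _ epi'.1 epi'.2) => _ _ /(_ _ tW) topp.
have [|A nA AW] := sT _ (conj topp _); last by exists A => // s /AW [].
by split; [exact: z0.2 | rewrite (sec_opp0 epi')].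
Qed.

Lemma small_sign k T : small_map pi pi' T -> small_map pi pi' (fun s => sec_sign k (T s)).
Proof. by rewrite /sec_sign /sign_E; case: (odd k) => //; exact: small_opp. Qed.

Lemma small_pull (phi : Y' -> Y) : continuous phi -> pi \o phi =1 pi' ->
  small_map pi pi' (fun s => s \o phi).
Proof.
move=> cphi /funext e W [tW W0]; case: epi epi' => hY lpi [hY' lpi'].
have lphi : local_homeo phi by apply: local_homeo_over cphi lpi _; rewrite e.
exists [set s | sections pi s /\ W (s \o phi)]; last by move=> s [].
split; first by apply: htop.2 => //; rewrite e.
split; first exact: (nbhs0_sections epi).2.
by rewrite (_ : _ \o phi = sec_zero S pi') // -e.
Qed.

End SmallMaps.

Lemma small_altsum (Y Y' : topologicalType) (pi : Y -> M) (pi' : Y' -> M)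
    (phi : nat -> Y' -> Y) n : etale pi -> etale pi' ->
  (forall k, continuous (phi k)) -> (forall k, pi \o phi k =1 pi') ->
  small_map pi pi' (altsum pi' n phi).
Proof.
move=> epi epi' cphi e; rewrite /altsum; elim: (index_iota 0 n) => [|k l IH] /=.
  exact: small_zero.
apply: (small_add epi epi' (T1 := fun s => sec_sign k (s \o phi k))) IH.
by apply: small_sign => //; exact: small_pull.
Qed.

End TopologizedSheaf.

(** * Face maps and the differential *)

Lemma bump_le_bump i j x : i <= j -> bump j.+1 (bump i x) = bump i (bump j x).
Proof. rewrite /bump; lia. Qed.

Section NerveMaps.
Variables (X : topologicalType) (K : choiceType) (W : K -> set X).

Lemma nerve_reindex_subproof (m m' : nat) (theta : nat -> nat) (z : nerve W m.+1) :
  inter W [ffun i : 'I_m' => nidx z (inord (theta i))] (nproj z).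
Proof. by move=> i; rewrite ffunE; exact: nerveP. Qed.

Definition nerve_reindex m m' theta : nerve W m.+1 -> nerve W m' :=
  nerve_lift (@nerve_reindex_subproof m m' theta).

(* For [k > m] this drops the last index, as [face m] does; the identities below
   hold for every [k] because [bump] is total. *)
Definition face m k : nerve W m.+1 -> nerve W m := nerve_reindex m (bump k).

Lemma nerve_reindex_continuous m m' theta : continuous (@nerve_reindex m m' theta).
Proof.
apply: nerve_lift_continuous; last exact: nproj_continuous.
by move=> z; apply: filterS (nidx_near z) => z' /= ->.
Qed.

Lemma face_continuous m k : continuous (@face m k).
Proof. exact: nerve_reindex_continuous. Qed.

Lemma face_face m i j (z : nerve W m.+2) : i <= j ->
  face i (face j.+1 z) = face j (face i z).
Proof.
move=> ij; apply: nerve_eq => //; apply/ffunP => x; rewrite !ffunE.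
congr (nidx z _); apply: val_inj.
have lx k : bump k x < m.+1 by rewrite /bump; have := ltn_ord x; lia.
have ly k y : y < m.+1 -> bump k y < m.+2 by rewrite /bump; lia.
by rewrite /= !inordK ?ly ?lx // bump_le_bump.
Qed.

Section Cech.
Variables (M : topologicalType) (S : sheafAb M) (piX : X -> M).
Local Notation E := (sh_E S).

(** At the indices and base point of an element of the nerve, the default branch of [ceval] is
    unreachable. *)
Lemma ceval_nidx m (f : nerve W m -> E) (z : nerve W m) s x :
  nidx z = s -> nproj z = x -> ceval piX f s x = f z.
Proof.
move=> <- <-; rewrite /ceval; case: pselect => [h|]; last by have := nerveP z.
by congr f; apply: nerve_eq.
Qed.

Lemma cech_deltaE m (f : nerve W m -> E) :
  cech_delta piX f = altsum (piX \o @nproj X K W m.+1) m.+1 (@face m) f.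
Proof.
apply: funext => z; rewrite /cech_delta /altsum /index_iota subn0 -val_enum_ord.
rewrite -map_comp; congr sh_sum; apply: eq_map => k /=; congr sign_E.
apply: ceval_nidx => //; apply/ffunP => i; rewrite !ffunE; congr (nidx z _).
by apply: val_inj; rewrite /= inordK //; exact: (ltn_ord (lift k i)).
Qed.

End Cech.
End NerveMaps.

(** * Algebra of alternating sums of pullbacks *)

Section AltSumAlgebra.
Variables (M : topologicalType) (S : sheafAb M).
Local Notation E := (sh_E S).

Lemma altsum_pull (Y Y' Z Z' : Type) (pi : Y' -> M) (pi' : Z' -> M) n
    (phi : nat -> Y' -> Y) (phi' : nat -> Z' -> Z) (chi : Z -> Y) (chi' : Z' -> Y')
    (f : Y -> E) :
  pi \o chi' =1 pi' -> (forall k z, phi k (chi' z) = chi (phi' k z)) ->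
  altsum pi n phi f \o chi' = altsum pi' n phi' (f \o chi).
Proof.
move=> e c; apply: funext => z; rewrite /altsum /= -e; congr sh_sum.
by apply: eq_map => k; rewrite /= c.
Qed.

Lemma altsum_altsum0 (Y Y' Y'' : Type) (pi : Y -> M) (pi' : Y' -> M) (pi'' : Y'' -> M)
    n (phi : nat -> Y' -> Y) (phi' : nat -> Y'' -> Y') (f : Y -> E) :
  (forall y, sh_p (f y) = pi y) -> (forall k z, pi (phi k z) = pi' z) ->
  (forall k z, pi' (phi' k z) = pi'' z) ->
  (forall i j z, i <= j -> phi i (phi' j.+1 z) = phi j (phi' i z)) ->
  altsum pi'' n.+1 phi' (altsum pi' n phi f) = sec_zero S pi''.
Proof.
move=> fP e e' simp; apply: funext => z.
have aP := altsumP fP e n.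
apply: (@germ_inj _ S (pi'' z)); [exact: altsumP aP e' _ _ | exact: sh_zeroP |].
rewrite germ0 (germ_altsum aP e') //.
under eq_bigr => i _ do rewrite (germ_altsum fP e) //.
by apply: alternating_sum_sq0 => i j ij; rewrite simp.
Qed.

Lemma altsum_add (Y Y' : Type) (pi : Y -> M) (pi' : Y' -> M) n (phi : nat -> Y' -> Y)
    (f g : Y -> E) :
  (forall y, sh_p (f y) = pi y) -> (forall y, sh_p (g y) = pi y) ->
  (forall k z, pi (phi k z) = pi' z) ->
  altsum pi' n phi (sec_add f g) = sec_add (altsum pi' n phi f) (altsum pi' n phi g).
Proof.
move=> fP gP e; apply: funext => z.
have fgP y : sh_p (sec_add f g y) = pi y by rewrite sh_addP ?fP ?gP.
apply: (@germ_inj _ S (pi' z)); first exact: altsumP fgP e _ _.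
  by rewrite sh_addP !(altsumP fP e, altsumP gP e).
rewrite germD ?(altsumP fP e, altsumP gP e) //.
rewrite (germ_altsum fgP e) // (germ_altsum fP e) // (germ_altsum gP e) //.
rewrite -big_split; apply: eq_bigr => k _ /=.
by rewrite germD ?fP ?gP ?e // mulrzDl.
Qed.

Lemma altsum_sign (Y Y' : Type) (pi : Y -> M) (pi' : Y' -> M) n (phi : nat -> Y' -> Y)
    (f : Y -> E) k :
  (forall y, sh_p (f y) = pi y) -> (forall k z, pi (phi k z) = pi' z) ->
  altsum pi' n phi (sec_sign k f) = sec_sign k (altsum pi' n phi f).
Proof.
move=> fP e; apply: funext => z.
have fkP y : sh_p (sec_sign k f y) = pi y by rewrite sign_EP.
apply: (@germ_inj _ S (pi' z)); first exact: altsumP fkP e _ _.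
  by rewrite sign_EP (altsumP fP e).
rewrite germ_sign ?(altsumP fP e) // (germ_altsum fkP e) // (germ_altsum fP e) //.
rewrite mulrz_suml; apply: eq_bigr => i _.
by rewrite germ_sign ?fP ?e // mulrzAC.
Qed.

Lemma altsum_zero (Y Y' : Type) (pi : Y -> M) (pi' : Y' -> M) n (phi : nat -> Y' -> Y) :
  (forall k z, pi (phi k z) = pi' z) ->
  altsum pi' n phi (sec_zero S pi) = sec_zero S pi'.
Proof.
move=> e; apply: funext => z; have zP y : sh_p (sec_zero S pi y) = pi y := sh_zeroP S _.
apply: (@germ_inj _ S (pi' z)); [exact: altsumP zP e _ _ | exact: sh_zeroP |].
rewrite germ0 (germ_altsum zP e) // big1 // => k _.
by rewrite /sec_zero e germ0 mul0rz.
Qed.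

End AltSumAlgebra.

(** * The double complex *)

Section Refinement.
Variables (M : topologicalType) (I J : choiceType).
Variables (U : I -> set M) (V : J -> set M) (tau : J -> I).
Hypothesis VU : forall j, V j `<=` U (tau j).

Lemma refine_map_subproof m (z : nerve V m) :
  inter U [ffun i => tau (nidx z i)] (nproj z).
Proof. by move=> i; rewrite ffunE; apply: VU; exact: nerveP. Qed.

Definition refine_map m : nerve V m -> nerve U m :=
  nerve_lift (@refine_map_subproof m).

Lemma refine_map_continuous m : continuous (@refine_map m).
Proof.
apply: nerve_lift_continuous; last exact: nproj_continuous.
by move=> z; apply: filterS (nidx_near z) => z' /= ->.
Qed.

Lemma cech_refineE (S : sheafAb M) m (f : nerve U m -> sh_E S) :
  cech_refine id tau f = f \o @refine_map m.
Proof. by apply: funext => z; apply: ceval_nidx. Qed.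

Lemma face_refine m k (z : nerve V m.+1) :
  face k (refine_map z) = refine_map (face k z).
Proof. by apply: nerve_eq => //; apply/ffunP => i; rewrite !ffunE. Qed.

Definition bicover p : J -> set (nerve U p.+1) :=
  fun j => @nproj M I U p.+1 @^-1` V j.

(** Carries the cochains of bidegree [(p, m - 1)]: there are [p.+1] indices from [I] but [m] from
    [J], so [m = 0] is the augmentation in the [V] direction. *)
Definition binerve p m : topologicalType := nerve (@bicover p) m.

Definition biproj p m : binerve p m -> M :=
  @nproj M I U p.+1 \o @nproj (nerve U p.+1) J (@bicover p) m.

Lemma biface_subproof p m k (z : binerve p.+1 m) :
  inter (@bicover p) (nidx z) (face k (nproj z)).
Proof. by move=> i; exact: nerveP z i. Qed.

Definition biface p m k : binerve p.+1 m -> binerve p m :=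
  nerve_lift (@biface_subproof p m k).

Lemma biface_continuous p m k : continuous (@biface p m k).
Proof.
apply: nerve_lift_continuous; first exact: nidx_near.
move=> z; apply: continuous_comp; [exact: nproj_continuous | exact: face_continuous].
Qed.

(** Leaving [n], [p], [m] independent avoids casts. The indices are the intended ones when [p <= n]
    and [p + m <= n.+1]; beyond that [inord] falls back to [0], which is still an index of [z]. *)
Lemma aw_map_subproof n p m (z : nerve V n.+1) :
  inter (@bicover p) [ffun i : 'I_m => nidx z (inord (p + i))]
    (nerve_reindex p.+1 id (refine_map z)).
Proof. by move=> i; rewrite ffunE; exact: nerveP z _. Qed.

(* [(j_0, ..., j_n)] is sent to [(tau j_0, ..., tau j_p; j_p, ..., j_(p+m-1))],
   the vertex [j_p] being shared as in the Alexander-Whitney cup product. *)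
Definition aw_map n p m : nerve V n.+1 -> binerve p m :=
  nerve_lift (@aw_map_subproof n p m).

Lemma aw_map_continuous n p m : continuous (@aw_map n p m).
Proof.
apply: nerve_lift_continuous.
  by move=> z; apply: filterS (nidx_near z) => z' /= ->.
move=> z; apply: continuous_comp; first exact: refine_map_continuous.
exact: nerve_reindex_continuous.
Qed.

Lemma to_empty_subproof p (y : nerve U p.+1) :
  inter (@bicover p) (ffun0 (card_ord 0)) y.
Proof. by case. Qed.

(** Without indices from [J], [binerve p 0] is a copy of [nerve U p.+1]; pulling back along this map
    turns the last cochain of the chase into a cochain of [U]. *)
Definition to_empty p : nerve U p.+1 -> binerve p 0 :=
  nerve_lift (@to_empty_subproof p).

Lemma to_empty_continuous p : continuous (@to_empty p).
Proof.
apply: nerve_lift_continuous => y; last exact.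
by apply: filterS (@filterT _ (nbhs y) _).
Qed.

Lemma to_emptyE p (w : binerve p 0) y : nproj w = y -> to_empty y = w.
Proof. by move=> <-; apply: nerve_eq => //; apply/ffunP => -[]. Qed.

Lemma forget_subproof m (z : binerve 0 m) : inter V (nidx z) (biproj z).
Proof. by move=> i; exact: nerveP z i. Qed.

(** Pullback along this map is the augmentation [D'] from cochains of [V] to bidegree
    [(0, m - 1)]. *)
Definition forget m : binerve 0 m -> nerve V m := nerve_lift (@forget_subproof m).

Lemma forget_continuous m : continuous (@forget m).
Proof.
apply: nerve_lift_continuous; first exact: nidx_near.
move=> z; apply: continuous_comp; exact: nproj_continuous.
Qed.

Lemma face_forget m k (z : binerve 0 m.+1) : face k (forget z) = forget (face k z).
Proof. exact: nerve_eq. Qed.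

Lemma forget_biface m k k' (z : binerve 1 m) :
  forget (biface k z) = forget (biface k' z).
Proof. exact: nerve_eq. Qed.

Lemma forget_aw_map n (z : nerve V n.+1) : forget (aw_map 0 n.+1 z) = z.
Proof.
by apply: nerve_eq => //; apply/ffunP => i; rewrite ffunE add0n inord_val.
Qed.

Lemma biface_face p m k l (z : binerve p.+1 m.+1) :
  biface k (face l z) = face l (biface k z).
Proof. exact: nerve_eq. Qed.

Lemma biface_biface p m i j (z : binerve p.+2 m) : i <= j ->
  biface i (biface j.+1 z) = biface j (biface i z).
Proof. by move=> ij; apply: nerve_eq => //; exact: face_face. Qed.

(** Deleting a vertex at or before position [p] makes the old vertex [p.+1] the shared one. *)
Lemma aw_map_face_le p q k (z : nerve V (p + q).+2) : k <= p ->
  aw_map p q.+1 (face k z) = biface k (aw_map p.+1 q.+1 z).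
Proof.
move=> kp; apply: nerve_eq.
  apply/ffunP => i; rewrite !ffunE; congr (nidx z _); apply: val_inj.
  by have hi := ltn_ord i; rewrite /= !inordK /bump; lia.
apply: nerve_eq => //; apply/ffunP => i; rewrite !ffunE; congr (tau (nidx z _)).
by apply: val_inj; have hi := ltn_ord i; rewrite /= !inordK /bump; lia.
Qed.

Lemma aw_map_face_gt p q l (z : nerve V (p + q).+2) :
  aw_map p q.+1 (face (p + l.+1) z) = face l.+1 (aw_map p q.+2 z).
Proof.
apply: nerve_eq.
  apply/ffunP => i; rewrite !ffunE; congr (nidx z _); apply: val_inj.
  by have hi := ltn_ord i; rewrite /= !inordK /bump; lia.
apply: nerve_eq => //; apply/ffunP => i; rewrite !ffunE; congr (tau (nidx z _)).
by apply: val_inj; have hi := ltn_ord i; rewrite /= !inordK /bump; lia.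
Qed.

(** Both sides are [(tau j_0, ..., tau j_p; j_(p+1), ..., j_(p+q+1))], the one tuple without a
    shared vertex. It is the term that cancels between [Psi D'] and [Psi D'']. *)
Lemma aw_map_shared p q (z : nerve V (p + q).+2) :
  biface p.+1 (aw_map p.+1 q.+1 z) = face 0 (aw_map p q.+2 z).
Proof.
apply: nerve_eq.
  apply/ffunP => i; rewrite !ffunE; congr (nidx z _); apply: val_inj.
  by have hi := ltn_ord i; rewrite /= !inordK /bump; lia.
apply: nerve_eq => //; apply/ffunP => i; rewrite !ffunE; congr (tau (nidx z _)).
by apply: val_inj; have hi := ltn_ord i; rewrite /= !inordK /bump; lia.
Qed.

Section Cochains.
Variable S : sheafAb M.
Local Notation E := (sh_E S).

(** No sign [(-1)^p] is built in, so the two differentials commute rather than anticommute; the sign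
    surfaces in [vdelta_aw_map]. *)
Definition bidelta p m : (binerve p m -> E) -> (binerve p.+1 m -> E) :=
  altsum (@biproj p.+1 m) p.+2 (@biface p m).

Local Notation vdelta p :=
  (@cech_delta M S (nerve U p.+1) (@nproj M I U p.+1) J (@bicover p) _).
Local Notation delta := (@cech_delta M S M id _ _ _).
Local Notation bproj W m := (id \o @nproj M _ W m).

Lemma vdelta_bidelta p m (b : binerve p m -> E) :
  (forall z, sh_p (b z) = biproj z) ->
  vdelta p.+1 (bidelta b) = bidelta (vdelta p b).
Proof.
move=> bP; rewrite !cech_deltaE; apply: funext => z.
have e k w : biproj (@biface p m k w) = biproj w by [].
have e' k w : biproj (@biface p m.+1 k w) = biproj w by [].
have f k w : biproj (face k w : binerve p m) = biproj (w : binerve p m.+1) by [].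
have f' k w : biproj (face k w : binerve p.+1 m) = biproj (w : binerve p.+1 m.+1) by [].
have uP := altsumP bP e p.+2; have vP := altsumP bP f m.+1.
apply: (@germ_inj _ S (biproj z)); rewrite ?(altsumP uP f') ?(altsumP vP e') //.
rewrite (germ_altsum uP f') // (germ_altsum vP e') //.
under eq_bigr => k _ do rewrite (germ_altsum bP e) // mulrz_suml.
under [in RHS]eq_bigr => k _ do rewrite (germ_altsum bP f) // mulrz_suml.
rewrite exchange_big; apply: eq_bigr => k _; apply: eq_bigr => l _.
by rewrite biface_face mulrzAC.
Qed.

Lemma bidelta_bidelta p m (b : binerve p m -> E) :
  (forall z, sh_p (b z) = biproj z) -> bidelta (bidelta b) = sec_zero S (@biproj p.+2 m).
Proof. by move=> bP; apply: altsum_altsum0 bP _ _ _ => // i j z; exact: biface_biface. Qed.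

Lemma bidelta_forget m (c : nerve V m -> E) :
  (forall z, sh_p (c z) = nproj z) ->
  bidelta (c \o @forget m) = sec_zero S (@biproj 1 m).
Proof.
move=> cP; apply: funext => z.
have cfP w : sh_p ((c \o @forget m) w) = biproj w by rewrite /= cP.
have e k w : biproj (@biface 0 m k w) = biproj w by [].
apply: (@germ_inj _ S (biproj z)); [exact: altsumP cfP e _ _ | exact: sh_zeroP |].
rewrite germ0 (germ_altsum cfP e) // big_nat_recr //= big_nat1.
by rewrite (forget_biface 0 1) mulrz_signS subrr.
Qed.

Lemma vdelta_aw_map p q (b : binerve p q.+1 -> E) :
  (forall z, sh_p (b z) = biproj z) ->
  vdelta p b \o @aw_map (p + q).+1 p q.+2 =
  sec_sign p (sec_add (delta (b \o @aw_map (p + q) p q.+1))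
                (sec_opp (bidelta b \o @aw_map (p + q).+1 p.+1 q.+1))).
Proof.
move=> bP; rewrite !cech_deltaE; apply: funext => z /=.
set x := nproj z.
have bdP w : sh_p ((b \o @aw_map (p + q) p q.+1) w) = nproj w by rewrite /= bP.
have e k w : biproj (@biface p q.+1 k w) = biproj w by [].
have f k w : biproj (face k w : binerve p q.+1) = biproj (w : binerve p q.+2) by [].
have g k (w : nerve V (p + q).+2) : nproj (face k w) = nproj w by [].
have uP := altsumP bP e p.+2; have vP := altsumP bP f q.+2.
have wP := altsumP bdP g (p + q).+2.
rewrite /sec_sign /sec_add /sec_opp.
have uz := uP (aw_map p.+1 q.+1 z); have vz := vP (aw_map p q.+2 z).
have wz := wP z; have nuz := etrans (sh_oppP _) uz.
have wuz := etrans (sh_addP (etrans wz (esym nuz))) wz.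
apply: (@germ_inj _ S x) => //; first by rewrite sign_EP.
rewrite (germ_sign _ wuz) (germD wz nuz) (germN uz).
rewrite (germ_altsum bP f) // (germ_altsum bP e) // (germ_altsum bdP g) //.
(* [A] lists the terms of [Psi D' b] and [B] those of [Psi D'' b]; the [k]-th term of
   [delta (Psi b)] is [A k] up to [k = p] and [B (k - p)] afterwards. *)
pose A k := germ x (b (biface k (aw_map p.+1 q.+1 z))).
pose B l := germ x (b (face l (aw_map p q.+2 z))).
have AB : A p.+1 = B 0%N by rewrite /A aw_map_shared.
have := alternating_sum_split q AB.
under eq_bigr => k _.
  rewrite (_ : (if _ then _ else _) = germ x ((b \o @aw_map (p + q) p q.+1) (face k z))).
    over.
  rewrite /=; case: leqP => kp; first by rewrite /A -aw_map_face_le.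
  by rewrite /B -[k in RHS](subnKC (ltnW kp)) -(subnSK kp) aw_map_face_gt.
by move=> ->; rewrite addrAC subrr add0r mulrz_signK.
Qed.

End Cochains.
End Refinement.

(** * Lifting small cocycles *)

Lemma etale_id (M : topologicalType) : hausdorff_space M -> etale (@id M).
Proof.
move=> hM; split=> //; split=> x; first exact: cvg_id.
exists setT; split=> //; first exact: openT; first by rewrite image_id; exact: openT.
by move=> A oA _; rewrite image_id.
Qed.

Lemma etale_nerve (M X : topologicalType) (pi : X -> M) (K : choiceType)
    (W : K -> set X) m : (forall k, open (W k)) -> etale pi ->
  etale (pi \o @nproj X K W m).
Proof.
move=> oW [hX lpi]; split; first exact: nerve_hausdorff.
by apply: local_homeo_comp => //; exact: nproj_local_homeo.
Qed.

Section Cocycles.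
Variables (M : topologicalType) (S : sheafAb M) (X : topologicalType) (piX : X -> M).
Variables (K : choiceType) (W : K -> set X).
Hypothesis piXc : continuous piX.
Local Notation E := (sh_E S).
Local Notation pr m := (piX \o @nproj X K W m).

Lemma nerve_proj_continuous m : continuous (pr m).
Proof. by move=> z; apply: continuous_comp; [exact: nproj_continuous | exact: piXc]. Qed.

Lemma cochains_delta m (f : nerve W m -> E) :
  cochains piX f -> cochains piX (cech_delta piX f).
Proof.
rewrite cech_deltaE => fc; apply: sections_altsum fc => //.
  exact: nerve_proj_continuous.
by move=> k; exact: face_continuous.
Qed.

Lemma cech_delta_delta m (f : nerve W m -> E) :
  cochains piX f -> cech_delta piX (cech_delta piX f) = sec_zero S (pr m.+2).
Proof.
move=> [_ fP]; rewrite !cech_deltaE; apply: altsum_altsum0 fP _ _ _ => //.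
by move=> i j z; exact: face_face.
Qed.

Lemma cech_delta_add m (f g : nerve W m -> E) : cochains piX f -> cochains piX g ->
  cech_delta piX (sec_add f g) = sec_add (cech_delta piX f) (cech_delta piX g).
Proof. by move=> [_ fP] [_ gP]; rewrite !cech_deltaE; exact: altsum_add fP gP _. Qed.

Lemma cech_delta_sign m k (f : nerve W m -> E) : cochains piX f ->
  cech_delta piX (sec_sign k f) = sec_sign k (cech_delta piX f).
Proof. by move=> [_ fP]; rewrite !cech_deltaE; exact: altsum_sign fP _. Qed.

Lemma cech_delta_zero m :
  cech_delta piX (sec_zero S (pr m)) = sec_zero S (pr m.+1).
Proof. by rewrite cech_deltaE; exact: altsum_zero. Qed.

End Cocycles.

Section SecAlgebra.
Variables (M : topologicalType) (S : sheafAb M) (Y : topologicalType) (pi : Y -> M).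
Implicit Types s t u v : Y -> sh_E S.

Lemma sec_sign_zero k : sec_sign k (sec_zero S pi) = sec_zero S pi.
Proof.
apply: funext => y; apply: (@germ_inj _ S (pi y)); rewrite ?sign_EP ?sh_zeroP //.
by rewrite germ_sign ?sh_zeroP // germ0 mul0rz.
Qed.

Lemma sec_addACA s t u v : sections pi s -> sections pi t -> sections pi u ->
  sections pi v ->
  sec_add (sec_add s t) (sec_add u v) = sec_add (sec_add s u) (sec_add t v).
Proof.
move=> [_ sP] [_ tP] [_ uP] [_ vP]; apply: funext => y; rewrite /sec_add.
have aP a b : sh_p a = pi y -> sh_p b = pi y -> sh_p (sh_add a b) = pi y :> M.
  by move=> ay bz; rewrite sh_addP // ay.
apply: (@germ_inj _ S (pi y)); rewrite ?aP //.
by rewrite !germD ?aP // addrACA.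
Qed.

Lemma sec_subrK s t : sections pi s -> sections pi t ->
  sec_add t (sec_add s (sec_opp t)) = s.
Proof.
move=> [_ sP] [_ tP]; apply: funext => y; rewrite /sec_add.
have aP a b : sh_p a = pi y -> sh_p b = pi y -> sh_p (sh_add a b) = pi y :> M.
  by move=> ay bz; rewrite sh_addP // ay.
have oP : sh_p (sec_opp t y) = pi y by rewrite sh_oppP.
apply: (@germ_inj _ S (pi y)); rewrite ?aP //.
by rewrite !germD ?aP // germN // addrC subrK.
Qed.

(** Sign bookkeeping of the zigzag step, with [s = delta (Psi b)], [t = f|V] and [u = delta g]. *)
Lemma sec_sign_sub k s t u : sections pi s -> sections pi t -> sections pi u ->
  sec_sign k (sec_add s (sec_opp (sec_add t u))) =
  sec_add (sec_sign k.+1 t) (sec_sign k (sec_add s (sec_opp u))).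
Proof.
move=> [_ sP] [_ tP] [_ uP]; apply: funext => y; rewrite /sec_add /sec_opp /sec_sign.
have aP a b : sh_p a = pi y -> sh_p b = pi y -> sh_p (sh_add a b) = pi y :> M.
  by move=> ay bz; rewrite sh_addP // ay.
have oP a : sh_p a = pi y -> sh_p (sh_opp a) = pi y :> M by rewrite sh_oppP.
have gP i a : sh_p a = pi y -> sh_p (sign_E i a) = pi y :> M by rewrite sign_EP.
apply: (@germ_inj _ S (pi y)); first by rewrite !(gP, aP, oP).
  by rewrite !(gP, aP, oP).
rewrite germD ?(gP, aP, oP) // !germ_sign ?(gP, aP, oP) //.
rewrite !germD ?(gP, aP, oP) // !germN ?(gP, aP, oP) // germD //.
by rewrite mulrz_signS -mulNrz -mulrzDl opprD addrCA.
Qed.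

End SecAlgebra.

(** * The zigzag and openness at each point *)

Section ZigZag.
Variables (M : topologicalType) (S : sheafAb M) (top : topologization S).
Variables (I J : choiceType) (U : I -> set M) (V : J -> set M) (tau : J -> I).
Hypotheses (hM : hausdorff_space M) (htop : is_topologization top).
Hypotheses (Uo : forall i, open (U i)) (Vo : forall j, open (V j)).
Hypothesis Vcover : \bigcup_j V j = setT.
Hypothesis VU : forall j, V j `<=` U (tau j).
Local Notation E := (sh_E S).
Local Notation bicover p := (@bicover M I J U V p).
Local Notation vdelta p m :=
  (@cech_delta M S (nerve U p.+1) (@nproj M I U p.+1) J (bicover p) m).
Local Notation delta W m := (@cech_delta M S M id _ W m).
Local Notation bproj W m := (id \o @nproj M _ W m).
Local Notation biproj p m := (@biproj M I J U V p m).

Hypothesis vdelta_open : forall p q : nat,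
  open_map_on
    (@cochain_opens M S (nerve U p.+1) (@nproj M I U p.+1) J (bicover p) top q)
    (subspace_opens
       (@cochain_opens M S (nerve U p.+1) (@nproj M I U p.+1) J (bicover p) top q.+1)
       (@cocycles M S (nerve U p.+1) (@nproj M I U p.+1) J (bicover p) q.+1))
    (vdelta p q).

Lemma etale_base (K : choiceType) (W : K -> set M) m :
  (forall k, open (W k)) -> etale (bproj W m).
Proof. by move=> oW; apply: etale_nerve => //; exact: etale_id. Qed.

Lemma etale_binerve p m : etale (biproj p m).
Proof.
apply: etale_nerve; last exact: etale_base.
by move=> j; move/continuousP: (@nproj_continuous M I U p.+1); apply.
Qed.

(** Openness gives existence and smallness of a primitive at once: the image of [B] is the trace on
    the cocycles of an open [O], which contains zero because [B] does. *)
Lemma cocycles_lift p q B : nbhs0 top (biproj p q) B ->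
  exists2 O, nbhs0 top (biproj p q.+1) O &
    forall a, O a -> vdelta p q.+1 a = sec_zero S (biproj p q.+2) ->
    exists2 b, B b & vdelta p q b = a.
Proof.
move=> [tB B0]; have [O [tO BO]] := vdelta_open tB.
have z0 : (vdelta p q @` B) (sec_zero S (biproj p q.+1)).
  by exists (sec_zero S (biproj p q)) => //; exact: cech_delta_zero.
exists O; first by split=> //; move: z0; rewrite BO => -[].
move=> a Oa da; have : (vdelta p q @` B) a.
  rewrite BO; split=> //; split=> //.
  exact: (top_sections htop (etale_binerve p q.+1) tO Oa).
by case=> b Bb <-; exists b.
Qed.

(** Each step trades one [V]-degree for one [U]-degree, so the induction is on [q] for all [p], with
    [n] the total degree. An equation ties [n] to [p + q] because [p + q.+1] and [p.+1 + q] are not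
    convertible. *)
Lemma zigzag q p n : n = p + q ->
  forall N1 N2, nbhs0 top (bproj U n.+1) N1 -> nbhs0 top (bproj V n) N2 ->
  exists2 O, nbhs0 top (biproj p q.+1) O &
    forall a, O a -> bidelta a = sec_zero S (biproj p.+1 q.+1) ->
    vdelta p q.+1 a = sec_zero S (biproj p q.+2) ->
    exists f g, [/\ N1 f, delta U n.+1 f = sec_zero S (bproj U n.+2), N2 g &
      a \o @aw_map M I J U V tau VU n p q.+1 =
      sec_add (f \o @refine_map M I J U V tau VU n.+1) (delta V n g)].
Proof.
elim: q p n => [|q IH] p n np N1 N2 nN1 nN2.
- rewrite addn0 in np; subst n.
  have [B nB BN1] := small_pull htop (etale_binerve p 0) (etale_base p.+1 Uo)
    (@to_empty_continuous M I J U V p) (fun=> erefl) nN1.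
  have [O nO OB] := cocycles_lift nB; exists O => // a Oa Da va.
  have [b Bb vb] := OB _ Oa va.
  have bS := top_sections htop (etale_binerve p 0) nB.1 Bb; have bP := bS.2.
  (* From degree [-1] to degree [0] the differential has a single term, restriction. *)
  have aE (w : binerve U V p 1) : a w = b (face 0 w).
    apply: (@germ_inj _ S (biproj p 1 w)); rewrite ?bP // -vb cech_deltaE.
      by rewrite (altsumP bP).
    by rewrite (germ_altsum bP) // big_nat1 expr0 mulr1z.
  exists (b \o @to_empty M I J U V p), (sec_zero S (bproj V p)); split.
  + exact: BN1.
  (* As [V] covers [M], [delta f = 0] can be tested on each [V_j]: over [y] it is the equation
     [D' a = 0] at the point whose only [J]-index is [j]. *)
  + apply: funext => y; have [j _ yj] : (\bigcup_j V j) (nproj y) by rewrite Vcover.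
    have h : inter (bicover p.+1) [ffun i : 'I_1 => j] y by move=> i; rewrite ffunE.
    pose w : binerve U V p.+1 1 := @nerve_lift _ _ _ _ unit (fun=> _) (fun=> y) (fun=> h) tt.
    have /(congr1 (fun s => s w)) := Da.
    rewrite /sec_zero cech_deltaE => <-; rewrite /altsum /bidelta; congr sh_sum.
    by apply: eq_map => k /=; rewrite aE; congr sign_E; congr b; exact: to_emptyE.
  + exact: nN2.2.
  + have fS := sections_pull (@to_empty_continuous M I J U V p) (fun=> erefl) bS.
    rewrite cech_delta_zero (sec_addr0 (pi := bproj V p.+1)); last first.
      exact: sections_pull (@refine_map_continuous M I J U V tau VU p.+1) _ fS.
    apply: funext => z; rewrite /= aE; congr b; apply/esym/to_emptyE.
    apply: nerve_eq => //; apply/ffunP => i; rewrite !ffunE.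
    by congr (tau (nidx z _)); rewrite /= inord_val.
- rewrite addnS in np; subst n.
  have eW := etale_binerve p q.+1; have eV := etale_base (p + q).+1 Vo.
  have eU := etale_base (p + q).+2 Uo.
  (* The witnesses will be [(-1)^(p+1) f] and [(-1)^p (Psi b - g)], where [f] and [g] come from the
     induction hypothesis for [D' b]; the neighbourhoods are pulled back through these formulas. *)
  have [N1' nN1' N1'N] := small_sign htop eU p.+1 (@small_id _ _ _ _ _) nN1.
  have [N2' nN2' N2'N] := small_sign htop eV p (@small_id _ _ _ _ _) nN2.
  have [A [B [nA nB AB]]] := nbhs0_add htop eV nN2'.
  have [A' nA' A'A] := small_pull htop eW eV (@aw_map_continuous _ _ _ _ _ _ VU (p + q) p q.+1)
    (fun=> erefl) nA.
  have [B' nB' B'B] := small_opp htop eV (@small_id _ _ _ _ _) nB.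
  have [O' nO' H] := IH p.+1 _ erefl N1' B' nN1' nB'.
  have [O'' nO'' O''O] := small_altsum htop p.+2 eW (etale_binerve p.+1 q.+1)
    (@biface_continuous _ _ _ U V p q.+1) (fun _ _ => erefl) nO'.
  have nI := nbhs0I htop eW nA' nO''.
  have [O nO OB] := cocycles_lift nI; exists O => // a Oa Da va.
  have [b [A'b O''b] vb] := OB _ Oa va.
  have bS := top_sections htop eW nI.1 (conj A'b O''b); have bP := bS.2.
  (* The side conditions are [D' D' b = 0] and [D'' D' b = D' D'' b = D' a = 0]. *)
  have [||f [g [N1f df B'g aw_b]]] := H _ (O''O _ O''b).
  + exact: bidelta_bidelta.
  + by rewrite vdelta_bidelta // vb.
  have fS := top_sections htop eU nN1'.1 N1f; have gS := top_sections htop eV nB'.1 B'g.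
  have frS : sections (bproj V (p + q).+2) (f \o @refine_map M I J U V tau VU _).
    by apply: sections_pull fS; first exact: refine_map_continuous.
  have bdS := sections_pull (@aw_map_continuous _ _ _ _ _ _ VU (p + q) p q.+1)
    (fun=> erefl) bS.
  exists (sec_sign p.+1 f), (sec_sign p (sec_add (b \o aw_map VU p q.+1) (sec_opp g))).
  split.
  + exact: N1'N.
  + by rewrite cech_delta_sign // df sec_sign_zero.
  + by apply: N2'N; apply: AB; [exact: A'A | exact: B'B].
  + rewrite -vb vdelta_aw_map // aw_b.
    have idc : continuous (@id M) by move=> x; exact: cvg_id.
    have dgS := cochains_delta idc gS; have dbS := cochains_delta idc bdS.
    rewrite (sec_sign_sub _ dbS frS dgS); congr sec_add.
    rewrite cech_delta_sign; last by apply: sections_add => //; exact: sections_opp.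
    congr sec_sign; rewrite cech_delta_add //; last exact: sections_opp.
    (* [sec_opp] is [sec_sign 1] by computation. *)
    by congr sec_add; rewrite (cech_delta_sign 1 gS).
Qed.

Lemma delta_refine m (f : nerve U m -> E) :
  delta U m f \o @refine_map M I J U V tau VU m.+1 =
  delta V m (f \o @refine_map M I J U V tau VU m).
Proof. by rewrite !cech_deltaE; apply: altsum_pull => // k z; exact: face_refine. Qed.

Lemma delta_forget m (c : nerve V m -> E) :
  vdelta 0 m (c \o @forget M I J U V m) = delta V m c \o @forget M I J U V m.+1.
Proof.
by rewrite !cech_deltaE; apply: esym; apply: altsum_pull => // k z; exact: face_forget.
Qed.

Lemma refine_delta_cocycle n f g : cocycles id f -> cochains id g ->
  cocycles id (sec_add (f \o @refine_map M I J U V tau VU n.+1) (delta V n g)).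
Proof.
move=> [fS df] gS; have idc : continuous (@id M) by move=> x; exact: cvg_id.
have frS : sections (bproj V n.+1) (f \o @refine_map M I J U V tau VU _).
  by apply: sections_pull fS; first exact: refine_map_continuous.
have dgS := cochains_delta idc gS.
split; first exact: sections_add.
rewrite cech_delta_add // cech_delta_delta // -delta_refine df.
by rewrite (sec_addr0 (sections_zero S _)) //; apply: nerve_proj_continuous.
Qed.

Lemma cocycle_sub n (c c0 : nerve V n -> E) : cocycles id c -> cocycles id c0 ->
  cocycles id (sec_add c (sec_opp c0)).
Proof.
move=> [cS dc] [c0S dc0]; have oS := sections_opp c0S; split; first exact: sections_add.
rewrite cech_delta_add // dc (cech_delta_sign 1 c0S) dc0.
rewrite (sec_sign_zero S (bproj V n.+1) 1).
by rewrite (sec_addr0 (sections_zero S _)) //; apply: nerve_proj_continuous => x;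
  exact: cvg_id.
Qed.

(** A cocycle [c] near [c0 = F (f0, g0)] differs from it by a small cocycle [d]. The zigzag writes
    [d] as [F (f, g)] with [f] and [g] small, and additivity gives [c = F (f0 + f, g0 + g)]. *)
Lemma refine_delta_open n (A : set ((nerve U n.+1 -> E) * (nerve V n -> E))) :
  prod_opens
    (subspace_opens (@cochain_opens M S M id I U top n.+1) (@cocycles M S M id I U n.+1))
    (@cochain_opens M S M id J V top n) A ->
  forall f0 g0, A (f0, g0) ->
  let F fg := sec_add (fg.1 \o @refine_map M I J U V tau VU n.+1) (delta V n fg.2) in
  exists2 B, top (bproj V n.+1) B /\ B (F (f0, g0)) &
    @cocycles M S M id J V n.+1 `&` B `<=` F @` A.
Proof.
move=> Aop f0 g0 Afg F; have idc : continuous (@id M) by move=> x; exact: cvg_id.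
have [B1 [B2 [[C1 [tC1 eB1]] tB2 B1f0 B2g0 BA]]] := Aop _ Afg.
move: B1f0; rewrite eB1 => -[/= [f0S df0] C1f0]; rewrite /= in B2g0.
have eU := etale_base n.+1 Uo; have eV := etale_base n Vo.
have eV' := etale_base n.+1 Vo; have eW := etale_binerve 0 n.+1.
have g0S := top_sections htop eV tB2 B2g0.
have [N1 nN1 N1C] := nbhs0_translate htop eU tC1 C1f0.
have [N2 nN2 N2B] := nbhs0_translate htop eV tB2 B2g0.
(* The chase starts in the column [p = 0] with [d \o forget], which [aw_map] takes back to [d]. *)
have [O nO H] := @zigzag n 0 n erefl N1 N2 nN1 nN2.
have [P nP PO] := small_pull htop eV' eW (@forget_continuous M I J U V n.+1)
  (fun=> erefl) nO.
have c0Z : cocycles id (F (f0, g0)) by apply: refine_delta_cocycle.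
have [B [tB Bc0] BP] := nbhs0_translateN htop eV' nP c0Z.1.
exists B => // c [cZ Bc].
have [dS dd] := cocycle_sub cZ c0Z; have Pd := BP _ Bc.
have [||f [g [N1f df N2g e]]] := H _ (PO _ Pd).
- exact/bidelta_forget/dS.2.
- by rewrite delta_forget dd.
have fS := top_sections htop eU nN1.1 N1f; have gS := top_sections htop eV nN2.1 N2g.
exists (sec_add f0 f, sec_add g0 g).
  apply: BA; split; last exact: N2B.
  rewrite eB1; split; last exact: N1C.
  split; first exact: sections_add.
  rewrite cech_delta_add // df0 df.
  by rewrite (sec_addr0 (sections_zero S _)) //; apply: nerve_proj_continuous.
have rS (h : nerve U n.+1 -> E) : cochains id h ->
    sections (bproj V n.+1) (h \o @refine_map M I J U V tau VU n.+1).
  by move=> hS; apply: sections_pull hS; first exact: refine_map_continuous.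
rewrite /F /= cech_delta_add //.
have -> : sec_add f0 f \o @refine_map M I J U V tau VU n.+1 =
  sec_add (f0 \o @refine_map M I J U V tau VU _) (f \o @refine_map M I J U V tau VU _) by [].
rewrite (sec_addACA (rS _ f0S) (rS _ fS) (cochains_delta idc g0S) (cochains_delta idc gS)).
rewrite -e -[RHS](sec_subrK cZ.1 c0Z.1); congr sec_add.
by apply: funext => z; rewrite /= forget_aw_map.
Qed.

End ZigZag.

Unset Implicit Arguments.

Theorem theorem2p2 (M : topologicalType) (S : sheafAb M) (top : topologization S)
  (I J : choiceType) (U : I -> set M) (V : J -> set M) :
  hausdorff_space M ->
  is_topologization top ->
  open_cover U -> open_cover V ->
  (* V is finer than U *)
  (exists tau : J -> I, forall j, V j `<=` U (tau j)) ->
  (* for p, q >= 0, delta^{q-1} : C^{q-1}(V|U_p, pi_p^{-1} S) -> Z^q(V|U_p, pi_p^{-1} S)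
     is open; U_p = nerve U p.+1 with pi_p = nproj, V|U_p = (pi_p^{-1} V_j)_j *)
  (forall p q : nat,
     open_map_on
       (@cochain_opens M S (nerve U p.+1) (@nproj M I U p.+1) J
          (fun j => @nproj M I U p.+1 @^-1` V j) top q)
       (subspace_opens
          (@cochain_opens M S (nerve U p.+1) (@nproj M I U p.+1) J
             (fun j => @nproj M I U p.+1 @^-1` V j) top q.+1)
          (@cocycles M S (nerve U p.+1) (@nproj M I U p.+1) J
             (fun j => @nproj M I U p.+1 @^-1` V j) q.+1))
       (@cech_delta M S (nerve U p.+1) (@nproj M I U p.+1) J
          (fun j => @nproj M I U p.+1 @^-1` V j) q)) ->
  (* for every refinement map tau and n >= 0, the map
     Z^n(U,S) x C^{n-1}(V,S) -> Z^n(V,S), (f,g) |-> f|V + delta g, is open *)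
  forall tau : J -> I, (forall j, V j `<=` U (tau j)) ->
  forall n : nat,
    open_map_on
      (prod_opens
         (subspace_opens (@cochain_opens M S M id I U top n.+1)
                         (@cocycles M S M id I U n.+1))
         (@cochain_opens M S M id J V top n))
      (subspace_opens (@cochain_opens M S M id J V top n.+1)
                      (@cocycles M S M id J V n.+1))
      (fun fg => sec_add (@cech_refine M S M id I J U V tau n.+1 fg.1)
                         (@cech_delta M S M id J V n fg.2)).
Proof.
move=> hM htop [Uo _] [Vo Vcover] _ vop tau VU n A Aop.
pose F (fg : (nerve U n.+1 -> sh_E S) * (nerve V n -> sh_E S)) :=
  sec_add (fg.1 \o @refine_map M I J U V tau VU n.+1) (cech_delta id fg.2).
have -> : (fun fg => sec_add (@cech_refine M S M id I J U V tau n.+1 fg.1)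
  (@cech_delta M S M id J V n fg.2)) = F.
  by apply: funext => fg; rewrite (cech_refineE VU).
have [[_ _ _ bigU] _ _] := htop.1 _ _ (etale_base hM n.+1 Vo).1 (etale_base hM n.+1 Vo).2.
(* Taking the union of all admissible [B] gives one open set for the whole image, without choosing a
   [B] at each point. *)
pose G := [set B | top _ (id \o @nproj M J V n.+1) B /\
  @cocycles M S M id J V n.+1 `&` B `<=` F @` A].
exists (\bigcup_(B in G) B); split; first by apply: bigU => B [].
apply/seteqP; split; last by move=> c [cZ [B [_ BF] Bc]]; exact: BF.
move=> _ [[f g] Afg <-].
have [B [tB Bfg] BF] := refine_delta_open hM htop Uo Vo Vcover VU vop Aop Afg.
have [B1 [B2 [[C1 [tC1 eB1]] tB2 B1f B2g _]]] := Aop _ Afg.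
split; last by exists B.
apply: refine_delta_cocycle; first by move: B1f; rewrite eB1 => -[].
exact: (top_sections htop (etale_base hM n Vo) tB2 B2g).
Qed.
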